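(* Let $q$ be a prime power, $n\ge2$, $E=\mathbb{F}_q^n$, and $1\le k\le n-1$. Let $\mathcal{S}_1,\mathcal{S}_2$ be collections of $k$-dimensional subspaces of $E$ such that, for $i=1,2$, $\dim(V\cap W)\le k-2$ for all distinct $V,W\in\mathcal{S}_i$, and assume $\mathcal{S}_1\cap\mathcal{S}_2=\emptyset$. Let $\mathcal{M}_i$ be the paving $q$-matroid induced by $\mathcal{S}_i$ ($i=1,2$), let $\lambda\in\mathbb{Q}$ with $0<\lambda<1$, and let $\mathcal{M}=\lambda\mathcal{M}_1+(1-\lambda)\mathcal{M}_2$. Then the collection of flats of $\mathcal{M}$ is $$\mathcal{F}_{\mathcal{M}}=\mathcal{S}_1\cup\mathcal{S}_2\cup\{E\}\cup\mathcal{L}(E)_{\le k-1}.$$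
   Context: $\mathcal{L}(E)$ is the lattice of subspaces of $E$ and $\mathcal{L}(E)_{\le i}$ the set of subspaces of dimension at most $i$. A $q$-polymatroid is $(\mathcal{L}(E),\rho)$ with $\rho:\mathcal{L}(E)\to\mathbb{R}$ satisfying $0\le\rho(A)\le\dim A$, monotonicity, and submodularity; a $q$-matroid if $\rho$ is integer-valued. The paving $q$-matroid induced by $\mathcal{S}$ has rank function $\rho_{\mathcal{S}}(V)=k-1$ if $V\in\mathcal{S}$ and $\min\{\dim V,k\}$ otherwise. The convex combination $\lambda\mathcal{M}_1+(1-\lambda)\mathcal{M}_2$ has rank function $\lambda\rho_1+(1-\lambda)\rho_2$. A subspace $X$ is a flat of a $q$-polymatroid with rank function $\rho$ if $\rho(X)<\rho(X+v)$ for every one-dimensional subspace $v\le E$ with $v\not\le X$. *)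

(* Defs.v *)
From HB Require Import structures.
From mathcomp Require Import all_boot all_order all_algebra.
From mathcomp Require Import zify lra.
From mathcomp Require Import all_classical all_reals.

Set Implicit Arguments.
Unset Strict Implicit.
Unset Printing Implicit Defensive.

Import Order.TTheory GRing.Theory Num.Theory.

Local Open Scope classical_set_scope.
Local Open Scope ring_scope.

Record qPolymatroid (R : realType) (K : finFieldType) (E : vectType K) :=
  QPolymatroid {
    qrank :> {vspace E} -> R;
    qrank_bounds : forall A, 0 <= qrank A <= (\dim A)%:R;
    qrank_mono : forall A B, (A <= B)%VS -> qrank A <= qrank B;
    qrank_submod : forall A B,
      qrank (A + B)%VS + qrank (A :&: B)%VS <= qrank A + qrank B
  }.

Record qMatroid (R : realType) (K : finFieldType) (E : vectType K) :=
  QMatroid {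
    qmatroid_poly :> qPolymatroid R E;
    qmatroid_int : forall A, qmatroid_poly A \is a Num.int
  }.

Definition is_flat (R : realType) (K : finFieldType) (E : vectType K)
    (M : qPolymatroid R E) (X : {vspace E}) : Prop :=
  forall v : {vspace E}, \dim v = 1%N -> ~~ (v <= X)%VS -> M X < M (X + v)%VS.

Definition flats (R : realType) (K : finFieldType) (E : vectType K)
    (M : qPolymatroid R E) : set {vspace E} :=
  [set X | is_flat M X].

Definition subspaces_le (K : finFieldType) (E : vectType K) (i : nat) :
    set {vspace E} :=
  [set X | (\dim X <= i)%N].

(* The bound dim (V :&: W) <= k - 2 is written without subtraction because
   k - 2 is negative for k = 1, where it forces S to have at most one
   element. *)
Definition paving_collection (K : finFieldType) (E : vectType K) (k : nat)
    (S : set {vspace E}) : Prop :=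
  (forall V, S V -> \dim V = k) /\
  (forall V W, S V -> S W -> V <> W -> (\dim (V :&: W) + 2 <= k)%N).

Definition paving_rank (K : finFieldType) (E : vectType K) (k : nat)
    (S : set {vspace E}) (V : {vspace E}) : nat :=
  if V \in S then (k - 1)%N else minn (\dim V) k.

Section PavingFacts.
Variables (R : realType) (K : finFieldType) (E : vectType K) (k : nat).
Variable S : set {vspace E}.
Hypothesis SP : paving_collection k S.
Local Notation rk := (paving_rank k S).

Let rk_le V : (rk V <= minn (\dim V) k)%N.
Proof.
rewrite /paving_rank; case: ifPn => // /set_mem VS.
by rewrite (SP.1 _ VS); lia.
Qed.

Lemma paving_rank_bounds A : 0 <= ((rk A)%:R : R) <= (\dim A)%:R.
Proof. by rewrite ler0n ler_nat (leq_trans (rk_le A)) ?geq_minl. Qed.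

Lemma paving_rank_mono A B : (A <= B)%VS -> (rk A)%:R <= (rk B)%:R :> R.
Proof.
move=> AB; rewrite ler_nat.
have [<-//|nAB] := eqVneq A B.
have lAB : (\dim A < \dim B)%N.
  rewrite ltnNge; apply: contra nAB => le.
  by rewrite eqEdim AB.
have := rk_le A; rewrite [rk B]/paving_rank.
case: ifPn => [/set_mem BS|_]; last by lia.
by have := SP.1 _ BS; lia.
Qed.

Lemma paving_rank_submod A B :
  (rk (A + B)%VS)%:R + (rk (A :&: B)%VS)%:R <= (rk A)%:R + (rk B)%:R :> R.
Proof.
rewrite -!natrD ler_nat.
have [AB|nAB] := boolP (A <= B)%VS.
  by rewrite (addv_idPr AB) (capv_idPl AB) addnC.
have [BA|nBA] := boolP (B <= A)%VS.
  by rewrite (addv_idPl BA) (capv_idPr BA).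
have iA : (\dim (A :&: B) < \dim A)%N.
  rewrite ltnNge; apply: contra nAB => le.
  have /eqP <- : (A :&: B == A)%VS by rewrite eqEdim capvSl.
  exact: capvSr.
have iB : (\dim (A :&: B) < \dim B)%N.
  rewrite ltnNge; apply: contra nBA => le.
  have /eqP <- : (A :&: B == B)%VS by rewrite eqEdim capvSr.
  exact: capvSl.
have s := dimv_sum_cap A B.
have := rk_le (A + B)%VS; have := rk_le (A :&: B)%VS.
rewrite [rk A]/paving_rank [rk B]/paving_rank.
case: ifPn => [/set_mem AS|_]; case: ifPn => [/set_mem BS|_]; last by lia.
- have ne : A <> B by move=> e; rewrite e subvv in nAB.
  by have := SP.2 _ _ AS BS ne; lia.
- by have := SP.1 _ AS; lia.
- by have := SP.1 _ BS; lia.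
Qed.

Definition paving_qPolymatroid : qPolymatroid R E :=
  @QPolymatroid R K E (fun V => (rk V)%:R)
    paving_rank_bounds paving_rank_mono paving_rank_submod.

Lemma paving_rank_int A : paving_qPolymatroid A \is a Num.int.
Proof. exact: natr_int. Qed.

Definition paving_qMatroid : qMatroid R E := QMatroid paving_rank_int.

End PavingFacts.

Section ConvexFacts.
Variables (R : realType) (K : finFieldType) (E : vectType K).
Variables (l : R) (l01 : 0 <= l <= 1) (M1 M2 : qPolymatroid R E).
Local Notation rho := (fun V => l * M1 V + (1 - l) * M2 V).

Lemma convex_rank_bounds A : 0 <= rho A <= (\dim A)%:R.
Proof.
have := qrank_bounds M1 A; have := qrank_bounds M2 A.
by case/andP: l01 => ? ? /andP[? ?] /andP[? ?]; apply/andP; split; nra.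
Qed.

Lemma convex_rank_mono A B : (A <= B)%VS -> rho A <= rho B.
Proof.
move=> AB; have := qrank_mono M1 AB; have := qrank_mono M2 AB.
by case/andP: l01 => ? ? ? ?; nra.
Qed.

Lemma convex_rank_submod A B :
  rho (A + B)%VS + rho (A :&: B)%VS <= rho A + rho B.
Proof.
have := qrank_submod M1 A B; have := qrank_submod M2 A B.
by case/andP: l01 => ? ? ? ?; nra.
Qed.

Definition convex_comb : qPolymatroid R E :=
  QPolymatroid convex_rank_bounds convex_rank_mono convex_rank_submod.

End ConvexFacts.

Lemma ratr_itv01 (R : realType) (l : rat) :
  0 < l < 1 -> 0 <= (ratr l : R) <= 1.
Proof. by case/andP=> l0 l1; rewrite ler0q ltW//= -(rmorph1 ratr) ler_rat ltW. Qed.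

(* Main.v *)
Require Import Defs.
From mathcomp Require Import all_boot all_order all_algebra.
From mathcomp Require Import zify lra.
From mathcomp Require Import all_classical all_reals.

(** By monotonicity, [X] is a flat of a proper convex combination iff every line
    outside [X] raises the rank of [X] in at least one of the two summands.
    In a paving q-matroid, adding a line raises the rank of [X] when
    [\dim X <= k - 1], unless the sum is a block; disjointness of the collections
    ensures that the sum is a block of at most one of them. A block always gains
    rank, because its rank is deficient and no larger space is a block; any other
    space of dimension at least [k] already has the maximal rank [k]. *)

Set Implicit Arguments.
Unset Strict Implicit.
Unset Printing Implicit Defensive.

Import Order.TTheory GRing.Theory Num.Theory.

Local Open Scope classical_set_scope.
Local Open Scope ring_scope.

Lemma dimv_add_line (K : fieldType) (E : vectType K) (X v : {vspace E}) :
  \dim v = 1%N -> ~~ (v <= X)%VS -> \dim (X + v) = (\dim X).+1.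
Proof.
move=> dv nvX; have s := dimv_sum_cap X v.
suff : (\dim (X :&: v) < 1)%N by lia.
rewrite ltnNge; apply: contra nvX => le1.
have /eqP <- : (X :&: v == v)%VS by rewrite eqEdim capvSr dv.
exact: capvSl.
Qed.

Lemma exists_line_notin (K : fieldType) (E : vectType K) (X : {vspace E}) :
  X <> fullv -> exists2 v : {vspace E}, \dim v = 1%N & ~~ (v <= X)%VS.
Proof.
move=> XnE; have /subvPn[u _ uX] : ~~ (fullv <= X)%VS.
  by apply: contra_notN XnE => EX; apply/eqP; rewrite eqEsubv subvf.
exists <[u]>%VS; last by rewrite -memvE.
by rewrite dim_vline; case: eqP uX => // ->; rewrite mem0v.
Qed.

Lemma is_flat_convex_comb (R : realType) (K : finFieldType) (E : vectType K)
    (l : R) (l01 : 0 <= l <= 1) (M1 M2 : qPolymatroid R E) (X : {vspace E}) :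
  0 < l < 1 ->
  is_flat (convex_comb l01 M1 M2) X <->
  forall v : {vspace E}, \dim v = 1%N -> ~~ (v <= X)%VS ->
    M1 X < M1 (X + v)%VS \/ M2 X < M2 (X + v)%VS.
Proof.
move=> /andP[l0 l1]; split=> flX v dv vX; have := flX v dv vX => /=.
  case: (ltP (M1 X)) => [|le1]; first by left.
  case: (ltP (M2 X)) => [|le2]; first by right.
  by move=> ?; exfalso; nra.
(* One summand gains with positive weight, and monotonicity keeps the other from losing. *)
have := qrank_mono M1 (addvSl X v); have := qrank_mono M2 (addvSl X v).
by move=> ? ? []; nra.
Qed.

Section PavingRank.
Variables (K : finFieldType) (E : vectType K) (k : nat) (S : set {vspace E}).
Hypothesis SP : paving_collection k S.

Lemma paving_rank_notin V : ~ S V -> paving_rank k S V = minn (\dim V) k.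
Proof. by rewrite /paving_rank; case: ifPn => // /set_mem. Qed.

Lemma paving_rank_le V : (paving_rank k S V <= k)%N.
Proof. by rewrite /paving_rank; case: ifP => _; lia. Qed.

Lemma paving_rank_block_line X v : (0 < k)%N -> S X ->
  \dim v = 1%N -> ~~ (v <= X)%VS ->
  (paving_rank k S X < paving_rank k S (X + v)%VS)%N.
Proof.
move=> k0 SX dv vX; have dXv := dimv_add_line dv vX; have dX := SP.1 _ SX.
(* [X + v] has dimension [k + 1], too large for a block, so its rank is [k] against [k - 1] for
   [X]. *)
rewrite [X in (_ < X)%N]paving_rank_notin; last by move/(SP.1 _); lia.
by rewrite /paving_rank mem_set// dXv; lia.
Qed.

(** No space of dimension below [k] is a block, so both ranks here are plain dimensions. *)
Lemma paving_rank_small_line X v : (\dim X < k)%N -> ~ S (X + v)%VS ->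
  \dim v = 1%N -> ~~ (v <= X)%VS ->
  (paving_rank k S X < paving_rank k S (X + v)%VS)%N.
Proof.
move=> dX SXv dv vX.
rewrite !paving_rank_notin// ?(dimv_add_line dv vX); first by lia.
by move/(SP.1 _); lia.
Qed.

End PavingRank.

Theorem theorem5p10 (R : realType) (F : finFieldType) (n k : nat)
    (n_ge2 : (2 <= n)%N) (k_ge1 : (1 <= k)%N) (k_le : (k <= n - 1)%N)
    (S1 S2 : set {vspace 'rV[F]_n})
    (hS1 : paving_collection k S1) (hS2 : paving_collection k S2)
    (S12 : S1 `&` S2 = set0)
    (l : rat) (hl : 0 < l < 1) :
  flats (convex_comb (ratr_itv01 R hl)
           (paving_qMatroid R hS1) (paving_qMatroid R hS2))
  = S1 `|` S2 `|` [set fullv] `|` @subspaces_le F 'rV[F]_n (k - 1).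
Proof.
have l01 : 0 < (ratr l : R) < 1.
  by case/andP: hl => l0 l1; rewrite ltr0q l0 -(rmorph1 ratr) ltr_rat.
(* Needs [1 <= k], since the subtraction truncates. *)
have ltk m : (m <= k - 1)%N = (m < k)%N by lia.
apply/seteqP; split=> X /=; rewrite /flats /= (is_flat_convex_comb _ _ _ _ l01).
  move=> flX; case: (pselect (S1 X)) => [|nS1X]; first by do 3 left.
  case: (pselect (S2 X)) => [|nS2X]; first by do 2 left; right.
  case: (pselect (X = fullv)) => [|/exists_line_notin [v dv vX]].
    by left; right.
  right; rewrite /subspaces_le /= ltk.
  have := flX v dv vX; rewrite /= !ltr_nat.
  rewrite (paving_rank_notin _ nS1X) (paving_rank_notin _ nS2X).
  (* In either case [minn (\dim X) k] lies strictly below a rank that is at most [k], which forces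
     [\dim X < k]. *)
  by case=> /leq_trans/(_ (paving_rank_le _ _ _)); rewrite gtn_min ltnn orbF.
move=> FX v dv vX /=; rewrite !ltr_nat.
case: FX => [[[S1X|S2X]|XE]|].
- by left; apply: paving_rank_block_line.
- by right; apply: paving_rank_block_line.
- by rewrite XE subvf in vX.
rewrite /subspaces_le /= ltk => dX.
(* If [X + v] is a block of [S1], its first rank stays at [k - 1 = \dim X], so the gain must come
   from the second matroid. *)
case: (pselect (S1 (X + v)%VS)) => S1Xv; last first.
  by left; apply: paving_rank_small_line.
right; apply: paving_rank_small_line => // S2Xv.
by have : (S1 `&` S2) (X + v)%VS by []; rewrite S12.
Qed.
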